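(* Let $g(S)=\sum_{j=p}^{q}c_jS^j\in\mathbb K[S,S^{-1}]$ with $c_pc_q\neq0$ and $p<-1$. Let $\{p_n\}_{n\ge0}$ be the associated monic eigenbasis of $\mathbb K[x]$, let $h(D)=Sg(S)=\sum_{k\ge0}h_kD^k$ (Taylor expansion at $D=0$), and put $J=\min\{q,-2\}$. For every integer $k>\max\{q+1,0\}$, $$h_k=(-1)^kP_g(k),\qquad P_g(k)=\sum_{j=p}^{J}c_j\binom{k-j-2}{-j-2}.$$ The expression $P_g(t)$ is a nonzero polynomial in $t$ of degree $-p-2$, with leading coefficient $\dfrac{c_p}{(-p-2)!}$. For every $k>\max\{q+1,0\}$ and $n\ge k$, the lag-$k$ recurrence coefficient is $$[p_{n-k}](xp_n)=-(-1)^kP_g(k)\,n^{\underline k}.$$ Consequently $P_g(k)$, and hence this coefficient, is nonzero for all sufficiently large $k$; every sufficiently deep lag therefore occurs, so the recurrence has no uniform finite lower bandwidth. Conversely, the eventual signed coefficients determine $P_g$ (that is, $P_g$ is the only polynomial $P\in\mathbb K[t]$ such that, for all sufficiently large $k$ and all $n\ge k$, $-(-1)^k[p_{n-k}](xp_n)=P(k)\,n^{\underline k}$), and hence determine the lowest Laurent term of $g$ through $$p=-\deg P_g-2,\qquad c_p=(-p-2)!\,[t^{-p-2}]P_g(t).$$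
   Context: $\mathbb K$ is a field of characteristic zero. $S$ acts on $\mathbb K[x]$ by $(Sf)(x)=f(x+1)$; $D=S-1$, $X=xS^{-1}$. Elements of $\mathbb K[S,S^{-1}]$ are expanded in $\mathbb K[[D]]$ at $D=0$ via $S=1+D$. The monic eigenbasis associated with $g$ is $p_n=\exp(G(D))\,x(x-1)\cdots(x-n+1)$, where $G\in D\mathbb K[[D]]$ with $G'=g$; equivalently, for any $\lambda\in\mathbb K$, $p_n$ is the unique monic degree-$n$ eigenpolynomial of $H=2(X+g)D-\lambda$ with eigenvalue $2n-\lambda$. For $v=\sum_ma_mp_m$ write $[p_m]v=a_m$; $[t^i]P(t)$ is the coefficient of $t^i$. For integers, $n^{\underline k}=n(n-1)\cdots(n-k+1)$, $n^{\underline 0}=1$. For $i\ge0$, $\binom{t}{i}=t(t-1)\cdots(t-i+1)/i!$ is the binomial polynomial, with rational coefficients regarded in $\mathbb Q\subset\mathbb K$, so $P_g(t)=\sum_{j=p}^Jc_j\binom{t-j-2}{-j-2}\in\mathbb K[t]$. A uniform finite lower bandwidth means an integer $r\ge0$ such that $xp_n\in\operatorname{span}\{p_{n+1},p_n,\ldots,p_{n-r}\}$ for every $n\ge0$ (with $p_j=0$ for $j<0$). *)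

(* Defs.v *)
From HB Require Import structures.
From mathcomp Require Import all_boot all_order all_algebra.
From mathcomp Require Import boolp classical_sets.

Set Implicit Arguments.
Unset Strict Implicit.
Unset Printing Implicit Defensive.

Import Order.TTheory GRing.Theory Num.Theory.
Local Open Scope ring_scope.

(* Formal power series R[[D]]: [fcoef f k] is the coefficient of D^k in f.   *)
Record fps (R : Type) := Fps { fcoef : nat -> R }.

HB.instance Definition _ (R : Type) := gen_eqMixin (fps R).
HB.instance Definition _ (R : Type) := gen_choiceMixin (fps R).

Lemma fpsP (R : Type) (f g : fps R) : fcoef f =1 fcoef g <-> f = g.
Proof. by split=> [|-> //]; case: f g => f [g] /= /funext->. Qed.

Section FpsRing.
Variable R : comNzRingType.
Implicit Types f g h : fps R.

Definition fps_zero : fps R := Fps (fun=> 0).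
Definition fps_opp f : fps R := Fps (fun k => - fcoef f k).
Definition fps_add f g : fps R := Fps (fun k => fcoef f k + fcoef g k).

Fact fps_addA : associative fps_add.
Proof. by move=> f g h; apply/fpsP => k /=; rewrite addrA. Qed.
Fact fps_addC : commutative fps_add.
Proof. by move=> f g; apply/fpsP => k /=; rewrite addrC. Qed.
Fact fps_add0 : left_id fps_zero fps_add.
Proof. by move=> f; apply/fpsP => k /=; rewrite add0r. Qed.
Fact fps_addN : left_inverse fps_zero fps_opp fps_add.
Proof. by move=> f; apply/fpsP => k /=; rewrite addNr. Qed.

HB.instance Definition _ := GRing.isZmodule.Build (fps R)
  fps_addA fps_addC fps_add0 fps_addN.

Definition fps_one : fps R := Fps (fun k => (k == 0%N)%:R).
Definition fps_mul f g : fps R :=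
  Fps (fun k => \sum_(i < k.+1) fcoef f i * fcoef g (k - i)%N).

Definition fps_trunc n f : {poly R} := \poly_(i < n) fcoef f i.

Lemma coef_fps_mul n k f g : (k < n)%N ->
  fcoef (fps_mul f g) k = (fps_trunc n f * fps_trunc n g)`_k.
Proof.
move=> ltkn; rewrite coefM; apply: eq_bigr => i _.
rewrite !coef_poly (leq_ltn_trans (leq_subr _ _) ltkn).
by rewrite (leq_ltn_trans _ ltkn) // -ltnS.
Qed.

Lemma eq_coefM (p p' r r' : {poly R}) k :
    (forall i, (i <= k)%N -> p`_i = p'`_i) ->
    (forall i, (i <= k)%N -> r`_i = r'`_i) ->
  (p * r)`_k = (p' * r')`_k.
Proof.
move=> epp err; rewrite !coefM; apply: eq_bigr => i _.
by rewrite err ?leq_subr // epp // -ltnS.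
Qed.

Lemma coef_trunc_mul k i f g : (i <= k)%N ->
  (fps_trunc k.+1 (fps_mul f g))`_i = (fps_trunc k.+1 f * fps_trunc k.+1 g)`_i.
Proof. by move=> leik; rewrite coef_poly ltnS leik (@coef_fps_mul k.+1). Qed.

Fact fps_mulA : associative fps_mul.
Proof.
move=> f g h; apply/fpsP => k; rewrite !(@coef_fps_mul k.+1) //.
transitivity ((fps_trunc k.+1 f * (fps_trunc k.+1 g * fps_trunc k.+1 h))`_k).
  by apply: eq_coefM => // i; apply: coef_trunc_mul.
by rewrite mulrA; apply: eq_coefM => // i leik; rewrite coef_trunc_mul.
Qed.
Fact fps_mulC : commutative fps_mul.
Proof.
by move=> f g; apply/fpsP => k; rewrite !(@coef_fps_mul k.+1) // mulrC.
Qed.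
Fact fps_mul1 : left_id fps_one fps_mul.
Proof.
move=> f; apply/fpsP => k /=; rewrite big_ord_recl /= mul1r subn0.
by rewrite big1 ?addr0 // => i _; rewrite mul0r.
Qed.
Fact fps_mulDl : left_distributive fps_mul +%R.
Proof.
move=> f g h; apply/fpsP => k /=; rewrite -big_split /=.
by apply: eq_bigr => i _; rewrite mulrDl.
Qed.
Fact fps_one_neq0 : fps_one != 0.
Proof.
by apply/eqP => /fpsP /(_ 0%N) /= /eqP; rewrite oner_eq0.
Qed.

HB.instance Definition _ := GRing.Zmodule_isComNzRing.Build (fps R)
  fps_mulA fps_mulC fps_mul1 fps_mulDl fps_one_neq0.

Definition fps_scale (a : R) f : fps R := Fps (fun k => a * fcoef f k).

Fact fps_scaleA a b f : fps_scale a (fps_scale b f) = fps_scale (a * b) f.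
Proof. by apply/fpsP => k /=; rewrite mulrA. Qed.
Fact fps_scale1 : left_id 1 fps_scale.
Proof. by move=> f; apply/fpsP => k /=; rewrite mul1r. Qed.
Fact fps_scaleDr : right_distributive fps_scale +%R.
Proof. by move=> a f g; apply/fpsP => k /=; rewrite mulrDr. Qed.
Fact fps_scaleDl f : {morph fps_scale^~ f : a b / a + b}.
Proof. by move=> a b; apply/fpsP => k /=; rewrite mulrDl. Qed.

HB.instance Definition _ := GRing.Zmodule_isLmodule.Build R (fps R)
  fps_scaleA fps_scale1 fps_scaleDr fps_scaleDl.

Fact fps_scaleAl (a : R) f g : a *: (f * g) = (a *: f) * g.
Proof.
apply/fpsP => k /=; rewrite mulr_sumr.
by apply: eq_bigr => i _; rewrite mulrA.
Qed.

HB.instance Definition _ := GRing.Lmodule_isLalgebra.Build R (fps R)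
  fps_scaleAl.

Definition fps_unit : {pred fps R} := [pred f | `[< exists g, g * f = 1 >]].
Definition fps_inv f : fps R := xget f [set g | g * f = 1].

Fact fps_mulVx : {in fps_unit, left_inverse 1 fps_inv *%R}.
Proof. by move=> f /asboolP; apply: (@xgetPex _ f [set g | g * f = 1]). Qed.
Fact fps_unitPl f g : g * f = 1 -> fps_unit f.
Proof. by move=> gf1; apply/asboolP; exists g. Qed.
Fact fps_inv_out : {in [predC fps_unit], fps_inv =1 id}.
Proof.
move=> f /asboolP nuf; rewrite /fps_inv; case: xgetP => // g _ gf1.
by case: nuf; exists g.
Qed.

HB.instance Definition _ := GRing.ComNzRing_hasMulInverse.Build (fps R)
  fps_mulVx fps_unitPl fps_inv_out.

Lemma fcoefD f g k : fcoef (f + g) k = fcoef f k + fcoef g k.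
Proof. by []. Qed.
Lemma fcoefZ a f k : fcoef (a *: f) k = a * fcoef f k.
Proof. by []. Qed.
Lemma fcoef1 k : fcoef (1 : fps R) k = (k == 0%N)%:R.
Proof. by []. Qed.
Lemma fcoefM f g k :
  fcoef (f * g) k = \sum_(i < k.+1) fcoef f i * fcoef g (k - i)%N.
Proof. by []. Qed.

Definition fps_D : fps R := Fps (fun k => (k == 1%N)%:R).
Definition fps_S : fps R := 1 + fps_D.

(* S is invertible in R[[D]], so the library power [fps_S ^ j], j : int, is   *)
(* the expansion at D = 0 of S^j for negative j as well.                      *)
Lemma fps_SVl : Fps (fun k => (-1) ^+ k) * fps_S = 1.
Proof.
apply/fpsP => -[|k]; rewrite fcoefM.
  by rewrite big_ord_recl big_ord0 /= expr0 mul1r !addr0.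
rewrite big_ord_recr big_ord_recr /= subnn subSnn /= big1 ?add0r.
  by rewrite !(addr0, add0r, mulr1) exprS mulN1r subrr.
move=> [i ltik] _ /=; rewrite subSn 1?ltnW // -[(k - i)%N]prednK ?subn_gt0 //.
by rewrite /= addr0 mulr0.
Qed.

Lemma fps_S_unit : fps_S \is a GRing.unit.
Proof. by apply/unitrPr; exists (Fps (fun k => (-1) ^+ k)); rewrite mulrC fps_SVl. Qed.

End FpsRing.

Arguments fps_D {R}.
Arguments fps_S {R}.

Definition irange (a b : int) : seq int :=
  if a <= b then [seq a + i%:Z | i <- iota 0 `|b - a|.+1] else [::].

Lemma mem_irange a b j : (j \in irange a b) = (a <= j <= b).
Proof.
rewrite /irange; case: ifPn => [leab | nleab]; last first.
  rewrite in_nil; apply/esym/negbTE; apply: contra nleab => /andP[].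
  exact: le_trans.
apply/mapP/andP => [[i] | [leaj lejb]].
  rewrite mem_iota /= add0n ltnS -lez_nat gez0_abs ?subr_ge0 // => leib ->.
  by rewrite lerDl -lerBrDl.
exists `|j - a|%N; last by rewrite gez0_abs ?subr_ge0 // addrCA subrr addr0.
rewrite mem_iota /= add0n ltnS -lez_nat !gez0_abs ?subr_ge0 //.
by rewrite lerD2r.
Qed.

Lemma irange_uniq a b : uniq (irange a b).
Proof.
rewrite /irange; case: ifP => // _; rewrite map_inj_uniq ?iota_uniq //.
by move=> i j /addrI [].
Qed.

(* The falling factorial polynomial x(x-1)...(x-n+1). *)
Definition ffact_poly (R : nzRingType) (n : nat) : {poly R} :=
  \prod_(i < n) ('X - i%:R%:P).

Lemma monic_ffact_poly (R : nzRingType) n : ffact_poly R n \is monic.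
Proof. by apply: monic_prod => i _; apply: monicXsubC. Qed.

Lemma size_ffact_poly (R : nzRingType) n : size (ffact_poly R n) = n.+1.
Proof. by rewrite size_prod_XsubC [index_enum _]unlock -enumT -cardT card_ord. Qed.

Section Laurent.
Variable K : fieldType.
Implicit Types (f g G : fps K) (v : {poly K}) (b : nat -> {poly K}).

(* Expansion in K[[D]] of the Laurent polynomial \sum_(p <= j <= q) c_j S^j.  *)
Definition laurent (p q : int) (c : int -> K) : fps K :=
  \sum_(j <- irange p q) c j *: fps_S ^ j.

Definition fps_deriv f : fps K := Fps (fun k => fcoef f k.+1 *+ k.+1).

Definition fps_prim g : fps K :=
  Fps (fun k => if k is m.+1 then fcoef g m / m.+1%:R else 0).

Lemma fps_primK g : [pchar K] =i pred0 -> fps_deriv (fps_prim g) = g.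
Proof.
move=> K0; apply/fpsP => k /=; rewrite -[LHS]mulr_natr divfK //.
by rewrite (pcharf0P K).1.
Qed.

(* exp(G) = \sum_m G^m / m!; since G has no constant term, only the terms    *)
(* with m <= k contribute to the coefficient of D^k.                         *)
Definition fps_exp G : fps K :=
  Fps (fun k => \sum_(m < k.+1) fcoef (G ^+ m) k / (m`!)%:R).

Definition shift_poly v : {poly K} := v \Po ('X + 1).
Definition delta_poly v : {poly K} := shift_poly v - v.

(* Action of K[[D]] on K[x]: D = S - 1 lowers the degree, so D^k v = 0 as     *)
(* soon as k >= size v.                                                      *)
Definition fps_act f v : {poly K} :=
  \sum_(k < size v) fcoef f k *: iter k delta_poly v.

Definition eigenbasis g (n : nat) : {poly K} :=
  fps_act (fps_exp (fps_prim g)) (ffact_poly K n).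

(* [p_m] v for the basis b. *)
Definition bcoef b (m : nat) v : K :=
  xget (fun=> 0) [set a : nat -> K | exists N,
    (forall i, (N <= i)%N -> a i = 0) /\ v = \sum_(i < N) a i *: b i] m.

(* x p_n \in span {p_(n+1), p_n, ..., p_(n-r)}; the truncated subtraction      *)
(* accounts for p_j = 0 when j < 0.                                          *)
Definition lower_bandwidth b (r : nat) : Prop :=
  forall n, exists a : nat -> K,
    'X * b n = \sum_(n - r <= m < n.+2) a m *: b m.

(* The binomial polynomial t(t-1)...(t-i+1)/i!. *)
Definition binom_poly (i : nat) : {poly K} := (i`!%:R)^-1 *: ffact_poly K i.

(* \sum_(p <= j <= J) c_j binom(t-j-2, -j-2); used with J <= -2, so that     *)
(* [absz] only turns -j-2 >= 0 into a natural number.                        *)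
Definition lag_poly (p J : int) (c : int -> K) : {poly K} :=
  \sum_(j <- irange p J)
     c j *: (binom_poly (absz (- j - 2)%R) \Po ('X - (j + 2)%:~R%:P)).

End Laurent.

Arguments laurent {K}.
Arguments fps_deriv {K}.
Arguments fps_prim {K}.
Arguments fps_exp {K}.
Arguments shift_poly {K}.
Arguments delta_poly {K}.
Arguments fps_act {K}.
Arguments eigenbasis {K}.
Arguments bcoef {K}.
Arguments lower_bandwidth {K}.
Arguments lag_poly {K}.

(* By [size_eigenbasis] and [bcoef_sum], [bcoef (eigenbasis g)] is given by   *)
(* the unique coordinates in the eigenbasis, never by the default of [xget]. *)
Section Coordinates.
Variable K : fieldType.
Implicit Types (f g G : fps K) (v : {poly K}) (b : nat -> {poly K}).

Lemma size_delta_poly v : (size (delta_poly v) <= (size v).-1)%N.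
Proof.
have sX : size ('X + 1 : {poly K}) = 2 by rewrite -[1]/(1%:P) size_XaddC.
have [->|v0] := eqVneq v 0.
  by rewrite /delta_poly /shift_poly comp_poly0 subrr size_poly0.
have ss : size (shift_poly v) = size v.
  by rewrite /shift_poly size_comp_poly2.
apply/leq_sizeP => j; rewrite -ltnS prednK ?size_poly_gt0 // coefB => lej.
have [lej'|ltj] := leqP (size v) j.
  by rewrite !nth_default ?subrr ?ss.
have <-: (size v).-1 = j by rewrite (@anti_leq (size v) j.+1) // lej ltj.
rewrite -{1}ss -!lead_coefE lead_coef_comp ?sX //.
by rewrite -[1]/(1%:P) lead_coefXaddC expr1n mulr1 subrr.
Qed.

Lemma size_iter_delta k v : (size (iter k delta_poly v) <= size v - k)%N.
Proof.
elim: k => [|k IHk]; first by rewrite subn0.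
apply: leq_trans (size_delta_poly _) _; rewrite subnS.
by rewrite -!subn1 leq_sub2r.
Qed.

Lemma fps_exp_coef0 G : fcoef (fps_exp G) 0 = 1.
Proof. by rewrite /= big_ord_recl big_ord0 addr0 fact0 divr1. Qed.

Lemma fps_act_delta f v :
  fps_act f v = fcoef f 0 *: v +
    \sum_(1 <= k < size v) fcoef f k *: iter k delta_poly v.
Proof.
rewrite /fps_act -(big_mkord xpredT (fun k => fcoef f k *: iter k delta_poly v)).
have [->|v0] := eqVneq v 0; first by rewrite size_poly0 !big_geq // scaler0 addr0.
by rewrite big_ltn ?size_poly_gt0.
Qed.

Lemma eigenbasis_lower g n :
  exists2 r, eigenbasis g n = ffact_poly K n + r & (size r <= n)%N.
Proof.
eexists.
  rewrite /eigenbasis fps_act_delta fps_exp_coef0 scale1r; reflexivity.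
rewrite size_ffact_poly big_nat; apply: leq_trans (size_sum _ _ _) _.
apply/bigmax_leqP_seq => k _ /andP[k0 _].
apply: leq_trans (size_scale_leq _ _) (leq_trans (size_iter_delta _ _) _).
by rewrite size_ffact_poly leq_subLR -addn1 addnC leq_add2r.
Qed.

Lemma size_eigenbasis g n : size (eigenbasis g n) = n.+1.
Proof.
have [r -> ler] := eigenbasis_lower g n.
by rewrite size_polyDl size_ffact_poly.
Qed.

Lemma monic_eigenbasis g n : eigenbasis g n \is monic.
Proof.
have [r -> ler] := eigenbasis_lower g n.
rewrite monicE lead_coefDl ?size_ffact_poly //.
by rewrite -monicE monic_ffact_poly.
Qed.

Lemma widen_sum b (a : nat -> K) N M :
    (N <= M)%N -> (forall i, (N <= i)%N -> a i = 0) ->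
  \sum_(i < N) a i *: b i = \sum_(i < M) a i *: b i.
Proof.
move=> leNM a0; rewrite -!(big_mkord xpredT (fun i => a i *: b i)).
rewrite [RHS](big_cat_nat (leq0n N) leNM) /= [X in _ = _ + X]big_nat.
by rewrite [X in _ = _ + X]big1 ?addr0 // => i /andP[leNi _]; rewrite a0 ?scale0r.
Qed.

Lemma size_sum_basis b (a : nat -> K) N : (forall n, size (b n) = n.+1) ->
  (size (\sum_(i < N) a i *: b i)%R <= N)%N.
Proof.
move=> sb; apply: (leq_trans (size_sum _ _ _)); apply/bigmax_leqP => i _.
by apply: leq_trans (size_scale_leq _ _) _; rewrite sb.
Qed.

Lemma lead_basis_neq0 b n : (forall n, size (b n) = n.+1) -> (b n)`_n != 0.
Proof.
move=> sb; have := lead_coef_eq0 (b n); rewrite lead_coefE sb /= => ->.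
by rewrite -size_poly_eq0 sb.
Qed.

Lemma sum_basis_eq0 b (a : nat -> K) N : (forall n, size (b n) = n.+1) ->
  \sum_(i < N) a i *: b i = 0 -> forall i, (i < N)%N -> a i = 0.
Proof.
move=> sb; elim: N => // N IHN; rewrite big_ord_recr /= => sum0.
have aN0 : a N = 0.
  have /eqP := congr1 (fun v : {poly K} => v`_N) sum0.
  rewrite coefD coef0 coefZ nth_default ?size_sum_basis // add0r mulf_eq0.
  by rewrite (negbTE (lead_basis_neq0 N sb)) orbF => /eqP.
move: sum0; rewrite aN0 scale0r addr0 => /IHN a0 i.
by rewrite ltnS leq_eqVlt => /predU1P[-> | /a0].
Qed.

Lemma basis_span b n v : (forall n, size (b n) = n.+1) -> (size v <= n)%N ->
  exists a : nat -> K, (forall i, (n <= i)%N -> a i = 0) /\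
    v = \sum_(i < n) a i *: b i.
Proof.
move=> sb; elim: n v => [|n IHn] v.
  rewrite leqn0 size_poly_eq0 => /eqP->; exists (fun=> 0); split=> //.
  by rewrite big_ord0.
move=> sv; pose e := v`_n / (b n)`_n.
have [|a [a0 va]] := IHn (v - e *: b n).
  apply/leq_sizeP => j; rewrite leq_eqVlt => /predU1P[<- | ltnj].
    by rewrite coefB coefZ divfK ?subrr // lead_basis_neq0.
  rewrite coefB coefZ !nth_default ?sb ?mulr0 ?subr0 //.
  exact: leq_trans sv _.
exists (fun i => if i == n then e else a i); split=> [i ltni|].
  by rewrite gtn_eqF // a0 // ltnW.
rewrite big_ord_recr /= eqxx; apply/eqP; rewrite -subr_eq va; apply/eqP.
by apply: eq_bigr => i _; rewrite ltn_eqF.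
Qed.

Lemma bcoef_sum b (a : nat -> K) N : (forall n, size (b n) = n.+1) ->
    (forall i, (N <= i)%N -> a i = 0) ->
  forall m, bcoef b m (\sum_(i < N) a i *: b i) = a m.
Proof.
move=> sb a0 m; rewrite /bcoef.
rewrite (@xget_unique _ _ _ a) //; first by exists N.
move=> a' [N' [a'0 eaa']]; apply/funext => i; apply/eqP; rewrite -subr_eq0.
pose M := maxn N N'; have leNM : (N <= M)%N by apply: leq_maxl.
have leNM' : (N' <= M)%N by apply: leq_maxr.
have [leMi | ltiM] := leqP M i.
  by rewrite a0 ?a'0 ?subrr //; [exact: leq_trans leMi | exact: leq_trans leMi].
apply/eqP; apply: (@sum_basis_eq0 b (fun i => a' i - a i) M) => //.
under eq_bigr do rewrite scalerBl.
by rewrite sumrB -(widen_sum b leNM a0) -(widen_sum b leNM' a'0) eaa' subrr.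
Qed.

Lemma bcoefK b v : (forall n, size (b n) = n.+1) ->
  v = \sum_(i < size v) bcoef b i v *: b i.
Proof.
move=> sb; have [a [a0 va]] := basis_span sb (leqnn (size v)).
rewrite {1}va; apply: eq_bigr => i _; congr (_ *: _); move: (nat_of_ord i) => m.
by rewrite [in RHS]va bcoef_sum.
Qed.

End Coordinates.

(* Main.v *)
Require Import Defs.
From HB Require Import structures.
From mathcomp Require Import all_boot all_order all_algebra.
From mathcomp Require Import ring zify.

(** Let E = exp(G), so that E' = g E and p_n = E x^(n), where x^(n) denotes
    the n-th falling factorial.  Since [D, x] = S, one has
    x f(D) = f(D) x - S f'(D), and with f = E the last term is E h.  As
    D^k x^(n) = n^_k x^(n-k), this gives
      x p_n = p_(n+1) + n p_n - \sum_k h_k n^_k p_(n-k),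
    hence the lag-k coefficient is - h_k n^_k.  For large k only the powers
    S^(j+1) with j <= -2 contribute to h_k, through the negative binomial
    series, which gives the polynomial P; its top degree comes from j = p
    alone, and in characteristic 0 its values at large integers are nonzero
    and determine it. *)

Set Implicit Arguments.
Unset Strict Implicit.
Unset Printing Implicit Defensive.

Import Order.TTheory GRing.Theory Num.Theory.
Local Open Scope ring_scope.

(** * Coefficients of the integer powers of S in the expansion in D *)

Section PowerSeries.
Variable R : comNzRingType.
Implicit Types f g : fps R.

Lemma fcoef_sum (I : Type) (r : seq I) (F : I -> fps R) k :
  fcoef (\sum_(i <- r) F i) k = \sum_(i <- r) fcoef (F i) k.
Proof. by elim/big_rec2: _ => // i x y _ <-. Qed.

Lemma fcoef_SM0 f : fcoef (fps_S * f) 0 = fcoef f 0.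
Proof. by rewrite fcoefM big_ord1 /= addr0 mul1r. Qed.

Lemma fcoef_SMS f k : fcoef (fps_S * f) k.+1 = fcoef f k.+1 + fcoef f k.
Proof.
rewrite fcoefM big_ord_recl big_ord_recl /= addr0 add0r !mul1r subn1.
by rewrite big1 => [|i _]; rewrite /= ?addr0 ?mul0r.
Qed.

Lemma fcoef_S_exprn n k : fcoef (fps_S ^+ n : fps R) k = 'C(n, k)%:R.
Proof.
elim: n k => [|n IHn] k; first by rewrite expr0 fcoef1 bin0n.
case: k => [|k]; first by rewrite exprS fcoef_SM0 IHn !bin0.
by rewrite exprS fcoef_SMS !IHn binS natrD.
Qed.

(** Negative binomial series: by Pascal's rule, S times the series claimed for m+1 is the one for m,
    and S can be cancelled because it is a unit. *)
Lemma fcoef_S_exprNn m k :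
  fcoef (fps_S ^- m.+1 : fps R) k = (-1) ^+ k * 'C(m + k, k)%:R.
Proof.
suff -> : fps_S ^- m.+1 = Fps (fun k => (-1) ^+ k * 'C(m + k, k)%:R) :> fps R by [].
have SU : (fps_S : fps R) \is a GRing.unit by apply: fps_S_unit.
elim: m => [|m IHm]; apply: (mulrI SU).
  rewrite expr1 mulrV // -[LHS](fps_SVl R) mulrC; congr (_ * _).
  by apply/fpsP => j /=; rewrite add0n binn mulr1.
rewrite exprS invrM ?unitrX // mulrCA mulrV // mulr1 IHm.
apply/fpsP => -[|j]; first by rewrite fcoef_SM0 /= !addn0 !bin0.
rewrite fcoef_SMS /= exprS addSn binS natrD addSnnS; ring.
Qed.

End PowerSeries.

(** * Formal derivative and exponential in K[[D]] *)

Section FallingFactorials.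
Variable K : fieldType.
Implicit Types (f g : fps K).

Lemma fps_derivM f g :
  fps_deriv (f * g) = fps_deriv f * g + f * fps_deriv g.
Proof.
apply/fpsP => k; rewrite fcoefD !fcoefM /=.
rewrite -sumrMnl.
rewrite (eq_bigr (fun i : 'I_k.+2 => fcoef f i *+ i * fcoef g (k.+1 - i) +
    fcoef f i * (fcoef g (k.+1 - i) *+ (k.+1 - i)))); last first.
  move=> i _; rewrite mulrnAl mulrnAr -mulrnDr subnKC //.
  by rewrite -ltnS.
rewrite big_split /=; congr (_ + _).
  rewrite big_ord_recl /= mulr0n mul0r add0r.
  by apply: eq_bigr => i _; rewrite subSS.
rewrite big_ord_recr /= subnn mulr0n mulr0 addr0.
by apply: eq_bigr => i _; rewrite subSn // -ltnS.
Qed.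

Lemma fps_derivX f m : fps_deriv (f ^+ m.+1) = f ^+ m * fps_deriv f *+ m.+1.
Proof.
elim: m => [|m IHm]; first by rewrite expr1 expr0 mul1r.
rewrite exprS fps_derivM IHm exprS [RHS]mulrS mulrC mulrnAr !mulrA.
by rewrite [_ * f ^+ m]mulrC mulrAC.
Qed.

Lemma fcoefX_eq0 f m k : fcoef f 0 = 0 -> (k < m)%N -> fcoef (f ^+ m) k = 0.
Proof.
move=> f0; elim: m k => // m IHm k ltkm; rewrite exprS fcoefM big1 // => i _.
case: i => -[|i] ltik /=; first by rewrite f0 mul0r.
by rewrite IHm ?mulr0 //; lia.
Qed.

Lemma natr_fact_neq0 m : [pchar K] =i pred0 -> (m`!%:R : K) != 0.
Proof. by move=> K0; rewrite (pcharf0P K).1 // -lt0n fact_gt0. Qed.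

(** Termwise, the derivative of f^(m+1)/(m+1)! is f' f^m/m!. The hypothesis on the constant term
    reconciles the different truncations of the exponential sum. *)
Lemma fps_deriv_exp f : [pchar K] =i pred0 -> fcoef f 0 = 0 ->
  fps_deriv (fps_exp f) = fps_deriv f * fps_exp f.
Proof.
move=> K0 f0.
apply/fpsP => k; rewrite [LHS]/= big_ord_recl [X in X + _]mul0r add0r -sumrMnl.
transitivity (\sum_(m < k.+1) fcoef (fps_deriv f * f ^+ m) k / m`!%:R).
  apply: eq_bigr => m _; rewrite [LHS]/= /bump add1n -mulrnAl.
  have -> : fcoef (f ^+ m.+1) k.+1 *+ k.+1 = fcoef (fps_deriv (f ^+ m.+1)) k by [].
  rewrite fps_derivX -scaler_nat fcoefZ factS natrM -mulf_div divff ?(pcharf0P K).1 // mul1r.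
  by rewrite [fps_deriv f * _]mulrC.
under eq_bigr do rewrite fcoefM mulr_suml.
rewrite exchange_big fcoefM; apply: eq_bigr => i _.
under eq_bigr do rewrite -mulrA.
rewrite -mulr_sumr; congr (_ * _).
(* The terms with m > k-i vanish since f^m starts at D^m, so the sum up to k is the coefficient of
   the exponential at k-i. *)
have le : ((k - i).+1 <= k.+1)%N by rewrite ltnS leq_subr.
rewrite -(big_mkord xpredT (fun m => fcoef (f ^+ m) (k - i) / m`!%:R)).
rewrite (big_cat_nat (leq0n _) le) /= [X in _ + X]big_nat [X in _ + X]big1.
  by rewrite addr0 big_mkord.
by move=> m /andP[ltm _]; rewrite fcoefX_eq0 ?mul0r.
Qed.

(** * Falling factorials under K[[D]] and under multiplication by x *)

Lemma ffact_polyS n : ffact_poly K n.+1 = ffact_poly K n * ('X - n%:R%:P).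
Proof. by rewrite /ffact_poly big_ord_recr. Qed.

Lemma mulX_ffact_poly n :
  'X * ffact_poly K n = ffact_poly K n.+1 + n%:R *: ffact_poly K n.
Proof. by rewrite ffact_polyS -mul_polyC; ring. Qed.

Lemma shift_ffact_poly n : shift_poly (ffact_poly K n.+1) =
  ('X + 1) * ffact_poly K n.
Proof.
rewrite /shift_poly /ffact_poly rmorph_prod big_ord_recl /=.
rewrite comp_polyB comp_polyX comp_polyC subr0; congr (_ * _).
apply: eq_bigr => i _; rewrite comp_polyB comp_polyX comp_polyC /bump /= add1n.
by rewrite -natr1 polyCD; ring.
Qed.

Lemma delta_ffact_poly n :
  delta_poly (ffact_poly K n) = n%:R *: ffact_poly K n.-1.
Proof.
case: n => [|n].
  by rewrite /delta_poly /shift_poly /ffact_poly big_ord0 rmorph1 subrr scale0r.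
rewrite /delta_poly shift_ffact_poly ffact_polyS -natr1 -mul_polyC polyCD /=.
by ring.
Qed.

Lemma delta_polyZ (a : K) v : delta_poly (a *: v) = a *: delta_poly v.
Proof. by rewrite /delta_poly /shift_poly linearZ scalerBr. Qed.

Lemma iter_delta_ffact_poly k n :
  iter k delta_poly (ffact_poly K n) = (n ^_ k)%:R *: ffact_poly K (n - k).
Proof.
elim: k => [|k IHk]; first by rewrite ffactn0 scale1r subn0.
rewrite iterS IHk delta_polyZ delta_ffact_poly scalerA -natrM subnS.
by rewrite ffactnSr.
Qed.

Lemma fps_act_ffact f n : fps_act f (ffact_poly K n) =
  \sum_(k < n.+1) (fcoef f k * (n ^_ k)%:R) *: ffact_poly K (n - k).
Proof.
rewrite /fps_act size_ffact_poly; apply: eq_bigr => k _.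
by rewrite iter_delta_ffact_poly scalerA.
Qed.

Lemma ffactnD n a d : n ^_ (a + d) = (n ^_ a * (n - a) ^_ d)%N.
Proof.
elim: d => [|d IHd]; first by rewrite addn0 ffactn0 muln1.
by rewrite addnS !ffactnSr IHd subnDA mulnA.
Qed.

(** Compatibility of the action with products, with g(D) already expanded: for f = exp(G) the
    right-hand side is a combination of the p_(n-k). *)
Lemma fps_actM_ffact f g n : fps_act (f * g) (ffact_poly K n) =
  \sum_(k < n.+1) (fcoef g k * (n ^_ k)%:R) *: fps_act f (ffact_poly K (n - k)).
Proof.
rewrite mulrC fps_act_ffact.
pose T k m := (fcoef g k * fcoef f (m - k) * (n ^_ m)%:R) *: ffact_poly K (n - m).
transitivity (\sum_(m < n.+1) \sum_(k < n.+1 | (k <= m)%N) T k m).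
  apply: eq_bigr => m _; rewrite fcoefM mulr_suml scaler_suml.
  by rewrite (big_ord_widen n.+1 (fun k => T k m)).
rewrite (exchange_big_dep xpredT) //=; apply: eq_bigr => k _.
rewrite fps_act_ffact scaler_sumr.
have lek : (k <= n)%N by rewrite -ltnS.
(* The constraint k <= m is removed by setting m = k + d; then [ffactnD] splits the falling
   power. *)
rewrite -(big_mkord (fun m => k <= m)%N (T k)).
rewrite (big_cat_nat (leq0n k)) ?(leqW lek) //=.
rewrite big_nat_cond big1 ?add0r; last by move=> m; lia.
rewrite -{1}[val k]add0n big_addn subSn // big_mkord.
apply: eq_big => [d | d _]; first by rewrite leq_addl.
rewrite /T addnK scalerA addnC ffactnD natrM subnDA; congr (_ *: _); ring.
Qed.

(* The operator identity [x f(D) = f(D) x - S f'(D)], applied to a falling factorial. *)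
Lemma mulX_fps_act_ffact f n : 'X * fps_act f (ffact_poly K n) =
  fps_act f (ffact_poly K n.+1) + n%:R *: fps_act f (ffact_poly K n)
  - fps_act (fps_S * fps_deriv f) (ffact_poly K n).
Proof.
have Sd k : fcoef (fps_S * fps_deriv f) k = k.+1%:R * fcoef f k.+1 + k%:R * fcoef f k.
  case: k => [|k]; first by rewrite fcoef_SM0 mul0r addr0 mul1r.
  by rewrite fcoef_SMS /= !mulr_natl.
(* From here on S f' is known only through its coefficients. *)
move: (fps_S * fps_deriv f) Sd => d Sd; rewrite !fps_act_ffact.
pose F m := ffact_poly K m.
have -> : 'X * (\sum_(k < n.+1) (fcoef f k * (n ^_ k)%:R) *: F (n - k)%N) =
   \sum_(k < n.+1) (fcoef f k * (n ^_ k)%:R) *: F (n - k).+1 +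
   \sum_(k < n.+1) (fcoef f k * (n ^_ k * (n - k))%:R) *: F (n - k)%N.
  rewrite mulr_sumr -big_split /=; apply: eq_bigr => k _.
  by rewrite -scalerAr mulX_ffact_poly scalerDr scalerA natrM mulrA.
(* Shift of k by one, so that every sum runs over the F (n - k); the added top term is zero because
   n^_(n+1) = 0. *)
have -> : \sum_(k < n.+1) (fcoef f k * (n ^_ k)%:R) *: F (n - k).+1 =
   fcoef f 0 *: F n.+1 +
   \sum_(k < n.+1) (fcoef f k.+1 * (n ^_ k.+1)%:R) *: F (n - k)%N.
  rewrite big_ord_recl /= mulr1 subn0; congr (_ + _).
  rewrite big_ord_recr /= [(n ^_ n.+1)%N]ffact_small // mulr0 scale0r addr0.
  by apply: eq_bigr => k _; rewrite /bump /= add1n -subSn ?subSS.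
rewrite [X in _ = X + _ - _]big_ord_recl /= mulr1 -!addrA; congr (_ + _).
rewrite scaler_sumr -!sumrB -!big_split /=; apply: eq_bigr => -[k lek] _ /=.
rewrite !scalerA -scalerBl -!scalerDl; congr (_ *: _).
rewrite /bump /= add1n.
rewrite Sd ffactSS ffactnSr !natrM natrB // -!natr1; ring.
Qed.

(** For f = E = exp(G), the correction S f' is E (S g), and [fps_actM_ffact] expands it in the
    eigenbasis. *)
Lemma mulX_eigenbasis g n : [pchar K] =i pred0 ->
  'X * eigenbasis g n = eigenbasis g n.+1 + n%:R *: eigenbasis g n
    - \sum_(k < n.+1) (fcoef (fps_S * g) k * (n ^_ k)%:R) *: eigenbasis g (n - k).
Proof.
move=> K0; rewrite /eigenbasis mulX_fps_act_ffact fps_deriv_exp //.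
by rewrite fps_primK // mulrA mulrC fps_actM_ffact mulrC.
Qed.

Lemma bcoef_mulX_eigenbasis g k n : [pchar K] =i pred0 -> (0 < k <= n)%N ->
  bcoef (eigenbasis g) (n - k) ('X * eigenbasis g n) =
  - (fcoef (fps_S * g) k * (n ^_ k)%:R).
Proof.
move=> K0 /andP[k0 lekn].
(* Coordinates indexed by i = n - k. The extra term n sits only at i = n, that is k = 0, which 0 < k
   excludes; the final 0 gives the finite support that [bcoef_sum] requires. *)
pose a i := if i == n.+1 then 1 else if (i <= n)%N then
  n%:R *+ (i == n) - fcoef (fps_S * g) (n - i) * (n ^_ (n - i))%:R else 0.
have -> : 'X * eigenbasis g n = \sum_(i < n.+2) a i *: eigenbasis g i.
  rewrite mulX_eigenbasis // -addrA [RHS]big_ord_recr /= [a n.+1]/a eqxx scale1r addrC.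
  congr (_ + _).
  have -> : n%:R *: eigenbasis g n =
     \sum_(i < n.+1) (n%:R *+ (i == n :> nat)) *: eigenbasis g i.
    rewrite big_ord_recr /= eqxx big1 ?add0r // => i _.
    by rewrite ltn_eqF // mulr0n scale0r.
  rewrite [X in _ - X](reindex_inj rev_ord_inj) /= -sumrB; apply: eq_bigr => i _.
  have lei : (i <= n)%N by rewrite -ltnS.
  by rewrite subSS subKn // -scalerBl /a (ltn_eqF (ltn_ord i)) lei.
rewrite bcoef_sum; first 1 last.
- exact: size_eigenbasis.
- by move=> i lti; rewrite /a gtn_eqF // leqNgt ltnW.
by rewrite /a ltn_eqF ?ltnS ?leq_subr // subKn // ltn_eqF ?sub0r //; lia.
Qed.

End FallingFactorials.

(** * The lag polynomial: values, degree and leading coefficient *)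

Lemma big_irange_widen (V : nmodType) (p J q : int) (F : int -> V) :
    J <= q -> (forall j, J < j <= q -> F j = 0) ->
  \sum_(j <- irange p q) F j = \sum_(j <- irange p J) F j.
Proof.
move=> leJq F0; rewrite (bigID (fun j => j <= J)) /= [X in _ + X]big1_seq ?addr0.
  rewrite -big_filter; apply/perm_big/uniq_perm => [||j].
  - exact/filter_uniq/irange_uniq.
  - exact: irange_uniq.
  by rewrite mem_filter !mem_irange; lia.
by move=> j; rewrite mem_irange => ?; apply: F0; lia.
Qed.

Section LagPolynomial.
Variable K : fieldType.
Hypothesis K0 : [pchar K] =i pred0.

Lemma horner_ffact_poly n m : (ffact_poly K n).[m%:R] = (m ^_ n)%:R.
Proof.
elim: n => [|n IHn]; first by rewrite /ffact_poly big_ord0 hornerE.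
rewrite ffact_polyS hornerM IHn hornerXsubC ffactnSr natrM.
have [lenm | ltmn] := leqP n m; first by rewrite natrB.
by rewrite ffact_small // !mul0r.
Qed.

Lemma horner_binom_poly i m : (binom_poly K i).[m%:R] = 'C(m, i)%:R.
Proof.
rewrite /binom_poly hornerZ horner_ffact_poly -bin_ffact natrM mulrC.
by rewrite mulfK ?natr_fact_neq0.
Qed.

(** With m = -j-2, the symmetry C(m+k, k) = C(m+k, m) fixes the lower index, which makes the
    coefficient polynomial in k up to sign. *)
Lemma fcoef_S_exprz_lt (j : int) k : j <= -2 ->
  fcoef (fps_S ^ (j + 1) : fps K) k =
  (-1) ^+ k * (binom_poly K (absz (- j - 2)%R)).[(k%:Z - j - 2)%:~R].
Proof.
move=> lej; pose m := absz (- j - 2)%R.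
have -> : j + 1 = - (m.+1)%:Z by rewrite /m; lia.
have -> : k%:Z - j - 2 = (m + k)%N by rewrite /m; lia.
rewrite -exprnN fcoef_S_exprNn -[X in X%:~R]/((m + k)%N%:Z) -pmulrn.
by rewrite horner_binom_poly -[in RHS]bin_sub ?leq_addr // addKn.
Qed.

(** Here S^(j+1) is a polynomial in D of degree j+1. *)
Lemma fcoef_S_exprz_ge (j : int) k : -1 <= j -> j + 1 < k%:Z ->
  fcoef (fps_S ^ (j + 1) : fps K) k = 0.
Proof.
move=> gej ltjk; have -> : j + 1 = (absz (j + 1))%:Z by lia.
by rewrite -exprnP fcoef_S_exprn bin_small //; lia.
Qed.

Lemma fcoef_S_laurent p q c k :
  fcoef (fps_S * laurent p q c : fps K) k =
  \sum_(j <- irange p q) c j * fcoef (fps_S ^ (j + 1)) k.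
Proof.
rewrite mulr_sumr fcoef_sum; apply: eq_bigr => j _.
by rewrite [fps_S * _]mulrC -scalerAl fcoefZ exprzDr ?fps_S_unit // expr1z.
Qed.

Lemma fcoef_S_laurent_lag p q c k : Num.max (q + 1) 0 < k%:Z ->
  fcoef (fps_S * laurent p q c : fps K) k =
  (-1) ^+ k * \sum_(j <- irange p (Num.min q (-2)))
    c j * (binom_poly K (absz (- j - 2)%R)).[(k%:Z - j - 2)%:~R].
Proof.
rewrite gt_max => /andP[ltqk k0]; rewrite fcoef_S_laurent.
rewrite (@big_irange_widen _ _ (Num.min q (-2))); first 1 last.
- by rewrite ge_min lexx.
- by move=> j; rewrite gt_min => ltj; rewrite fcoef_S_exprz_ge ?mulr0 //; lia.
rewrite mulr_sumr; apply: eq_big_seq => j; rewrite mem_irange le_min => lej.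
by rewrite fcoef_S_exprz_lt 1?mulrCA //; lia.
Qed.

Lemma horner_lag_poly p J (c : int -> K) k :
  (lag_poly p J c).[k%:R] = \sum_(j <- irange p J)
    c j * (binom_poly K (absz (- j - 2)%R)).[(k%:Z - j - 2)%:~R].
Proof.
rewrite /lag_poly horner_sum; apply: eq_bigr => j _.
rewrite hornerZ horner_comp hornerXsubC; congr (_ * _.[_]).
by rewrite -addrA -opprD intrB -pmulrn.
Qed.

Lemma size_binom_poly_comp i (a : K) :
  size (binom_poly K i \Po ('X - a%:P)) = i.+1.
Proof.
rewrite size_comp_poly2 ?size_XsubC // size_scale ?invr_eq0 ?natr_fact_neq0 //.
exact: size_ffact_poly.
Qed.

Lemma lead_coef_binom_poly_comp i (a : K) :
  lead_coef (binom_poly K i \Po ('X - a%:P)) = i`!%:R^-1.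
Proof.
rewrite lead_coef_comp ?size_XsubC // lead_coefXsubC expr1n mulr1.
by rewrite lead_coefZ (eqP (monic_ffact_poly K i)) mulr1.
Qed.

(** The binomial attached to j has degree -j-2, strictly decreasing in j, so the summand j = p
    dominates. *)
Lemma lag_poly_lead p J (c : int -> K) : p <= J -> J <= -2 -> c p != 0 ->
  size (lag_poly p J c) = (absz (- p - 2)%R).+1 /\
  lead_coef (lag_poly p J c) = c p / (absz (- p - 2)%R)`!%:R.
Proof.
move=> lepJ leJ cp0; rewrite /lag_poly (bigD1_seq p) ?irange_uniq //=; last first.
  by rewrite mem_irange lexx.
set A := c p *: _; set B := \sum_(_ <- _ | _) _.
have sA : size A = (absz (- p - 2)%R).+1.
  by rewrite size_scale // size_binom_poly_comp.
have sB : (size B < size A)%N.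
  rewrite sA ltnS /B big_seq_cond; apply: leq_trans (size_sum _ _ _) _.
  apply/bigmax_leqP_seq => j _; rewrite mem_irange => /andP[? ?].
  by apply: leq_trans (size_scale_leq _ _) _; rewrite size_binom_poly_comp; lia.
rewrite size_polyDl // lead_coefDl // sA; split=> //.
by rewrite lead_coefZ lead_coef_binom_poly_comp.
Qed.

(** * Polynomials evaluated at large natural numbers in characteristic zero *)

Lemma natr_inj m n : (m%:R : K) = n%:R -> m = n.
Proof.
wlog lemn : m n / (m <= n)%N => [wl|/eqP].
  by case/orP: (leq_total m n) => le e; [| symmetry]; apply: wl.
rewrite eq_sym -subr_eq0 -natrB // (pcharf0P K).1 // subn_eq0 => lenm.
by apply/eqP; rewrite eqn_leq lemn.
Qed.

(** Natural roots are divided out one at a time, by induction on the size; beyond a root m, the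
    factor X - m no longer vanishes. *)
Lemma horner_neq0_large (Q : {poly K}) : Q != 0 ->
  exists k0, forall k, (k0 <= k)%N -> Q.[k%:R] != 0.
Proof.
have [n] := ubnP (size Q); elim: n Q => // n IHn Q ltQn Q0.
have [[m /factor_theorem[Q' QE]] | noroot] :=
  boolp.pselect (exists m, root Q m%:R); last first.
  by exists 0 => k _; apply/negP => Qk; apply: noroot; exists k.
have Q'0 : Q' != 0 by apply: contraNneq Q0 => Q'0; rewrite QE Q'0 mul0r.
have [|k0 Q'k] := IHn Q' _ Q'0.
  by move: ltQn; rewrite QE size_Mmonic ?monicXsubC // size_XsubC addn2.
exists (maxn k0 m.+1) => k; rewrite geq_max => /andP[lek ltmk].
rewrite QE hornerM hornerXsubC mulf_neq0 ?Q'k // subr_eq0.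
by apply/eqP => /natr_inj ekm; rewrite ekm ltnn in ltmk.
Qed.

Lemma eq_poly_large (P Q : {poly K}) k0 :
  (forall k, (k0 <= k)%N -> P.[k%:R] = Q.[k%:R]) -> P = Q.
Proof.
move=> ePQ; apply/eqP; rewrite -subr_eq0; apply/negPn/negP.
move=> /horner_neq0_large[k1 nz].
have := nz (maxn k0 k1) (leq_maxr _ _).
by rewrite hornerD hornerN ePQ ?leq_maxl // subrr eqxx.
Qed.

End LagPolynomial.

(** * Deep lags, unbounded bandwidth and recovery of the lowest Laurent term *)

Theorem theorem5p5 (K : fieldType) (p q : int) (c : int -> K)
    (charK0 : [pchar K] =i pred0) (le_pq : p <= q)
    (cpq_neq0 : c p * c q != 0) (lt_p : p < -1) :
  let g : fps K := laurent p q c in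
  let b : nat -> {poly K} := eigenbasis g in
  let h : fps K := fps_S * g in
  let J : int := Num.min q (-2) in
  let P : {poly K} := lag_poly p J c in
  let lag (k n : nat) : K := bcoef b (n - k) ('X * b n) in
  (* the Taylor coefficients of h *)
  (forall k : nat, Num.max (q + 1) 0 < k%:Z ->
     fcoef h k = (-1) ^+ k * P.[k%:R] /\
     P.[k%:R] =
       \sum_(j <- irange p J)
          c j * (binom_poly K (absz (- j - 2)%R)).[(k%:Z - j - 2)%:~R])
  /\
  (* degree and leading coefficient of P *)
  [/\ P != 0,
      ((size P).-1)%:Z = - p - 2
    & lead_coef P = c p / ((absz (- p - 2)%R)`!)%:R]
  /\
  (* the lag-k recurrence coefficients *)
  (forall k n : nat, Num.max (q + 1) 0 < k%:Z -> (k <= n)%N ->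
     lag k n = - (-1) ^+ k * P.[k%:R] * (n ^_ k)%:R)
  /\
  (* every sufficiently deep lag occurs *)
  (exists k0 : nat, forall k : nat, (k0 <= k)%N ->
     P.[k%:R] != 0 /\ (forall n : nat, (k <= n)%N -> lag k n != 0))
  /\
  ~ (exists r : nat, lower_bandwidth b r)
  /\
  (* the eventual signed coefficients determine P *)
  (forall Q : {poly K},
     (exists k0 : nat, forall k n : nat, (k0 <= k)%N -> (k <= n)%N ->
        - (-1) ^+ k * lag k n = Q.[k%:R] * (n ^_ k)%:R)
     <-> Q = P)
  /\
  (* and hence the lowest Laurent term of g *)
  (p = - ((size P).-1)%:Z - 2 /\
   c p = ((absz (- p - 2)%R)`!)%:R * P`_(absz (- p - 2)%R)).
Proof.
move=> g b h J P lag.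
have [cp0 _] : c p != 0 /\ c q != 0 by apply/andP; rewrite -negb_or -mulf_eq0.
have ltp : p <= -2 by lia.
have lepJ : p <= J by rewrite le_min le_pq.
have leJ : J <= -2 by rewrite ge_min lexx orbT.
have [sP lcP] := lag_poly_lead charK0 lepJ leJ cp0.
rewrite -/P in sP lcP.
have P0 : P != 0 by rewrite -size_poly_eq0 sP.
have hP k : Num.max (q + 1) 0 < k%:Z -> fcoef h k = (-1) ^+ k * P.[k%:R].
  by move=> ltk; rewrite /h fcoef_S_laurent_lag // horner_lag_poly.
have lagP k n : Num.max (q + 1) 0 < k%:Z -> (k <= n)%N ->
    lag k n = - (-1) ^+ k * P.[k%:R] * (n ^_ k)%:R.
  move=> ltk lekn; rewrite /lag bcoef_mulX_eigenbasis // -/h.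
    by rewrite hP // !mulNr.
  by move: ltk; rewrite gt_max lekn andbT => /andP[].
(* A natural number exceeding both q+1 and 0, whatever the sign of q. *)
pose k1 := (absz q).+2.
have k1P k : (k1 <= k)%N -> Num.max (q + 1) 0 < k%:Z.
  by rewrite gt_max /k1; lia.
have ffact_neq0 k n : (k <= n)%N -> ((n ^_ k)%:R : K) != 0.
  by rewrite (pcharf0P K).1 // -lt0n ffact_gt0.
have [k2 Pk] := horner_neq0_large charK0 P0.
have lag_neq0 k n : (maxn k1 k2 <= k)%N -> (k <= n)%N -> lag k n != 0.
  rewrite geq_max => /andP[/k1P ltk lek] lekn; rewrite lagP //.
  by rewrite !mulf_neq0 ?oppr_eq0 ?signr_eq0 ?Pk ?ffact_neq0.
split; first by move=> k ltk; rewrite hP // horner_lag_poly.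
split; first by split=> //; rewrite sP; lia.
split; first exact: lagP.
split.
  exists (maxn k1 k2) => k lek; split; last by move=> n; apply: lag_neq0.
  by rewrite Pk // (leq_trans (leq_maxr k1 _) lek).
split.
  (* Take n = k > r: the lag-k coefficient is the coordinate on p_0, which is nonzero, while the
     assumed span starts at p_(k-r) with k-r > 0. *)
  case=> r bw; pose k := maxn r.+1 (maxn k1 k2); have [a Xb] := bw k.
  have := lag_neq0 k k (leq_maxr _ _) (leqnn k).
  have ltrk : (r < k)%N by apply: leq_maxl.
  rewrite /lag Xb subnn; pose a' i := if (k - r <= i < k.+2)%N then a i else 0.
  have -> : \sum_(k - r <= m < k.+2) a m *: b m = \sum_(i < k.+2) a' i *: b i.
    rewrite -(big_mkord xpredT (fun i => a' i *: b i)).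
    rewrite [RHS](big_cat_nat (leq0n (k - r))) /=; last by lia.
    rewrite [X in _ = X + _]big_nat [X in _ = X + _]big1 ?add0r.
      by apply: eq_big_nat => i lti; rewrite /a' lti.
    by move=> i ?; rewrite /a' ifF ?scale0r //; lia.
  rewrite bcoef_sum; first by rewrite /a' ifF ?eqxx //; lia.
    exact: size_eigenbasis.
  by move=> i lei; rewrite /a' ifF //; lia.
split.
  have sgn k : - (-1) ^+ k * (- (-1) ^+ k) = 1 :> K.
    by rewrite mulrNN -expr2 sqrr_sign.
  move=> Q; split=> [[k0 Qk] | ->].
    apply: (@eq_poly_large _ charK0 _ _ (maxn k0 k1)) => k.
    rewrite geq_max => /andP[lek /k1P ltk].
    (* The case n = k suffices: the factor k^_k = k! cancels, so Q and P agree at all large k. *)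
    apply: (mulIf (ffact_neq0 k k (leqnn k))).
    by rewrite -Qk // lagP // !mulrA sgn mul1r.
  exists k1 => k n /k1P ltk lekn.
  by rewrite lagP // !mulrA sgn mul1r.
split; first by rewrite sP; lia.
have -> : P`_(absz (- p - 2)%R) = lead_coef P by rewrite lead_coefE sP.
by rewrite lcP mulrC divfK ?natr_fact_neq0.
Qed.
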